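(* Let $\mathfrak{g}$ be a real Lie algebra of finite dimension $n \geq 4$ which admits a Milnor frame. Then $\mathfrak{g}$ is isomorphic, as a Lie algebra, to a direct sum $$(\oplus\, \mathfrak{h}^3) \oplus (\oplus\, \mathfrak{h}^4) \oplus \mathfrak{a}$$ of finitely many (possibly zero) copies of $\mathfrak{h}^3$, finitely many (possibly zero) copies of $\mathfrak{h}^4$, and an abelian (possibly zero) Lie algebra $\mathfrak{a}$. Moreover, every such $\mathfrak{g}$ is at most 3-step nilpotent, i.e. $[\mathfrak{g},[\mathfrak{g},[\mathfrak{g},\mathfrak{g}]]] = 0$.
   Context: All Lie algebras are real and finite-dimensional; a frame is an ordered basis. For a Lie algebra $\mathfrak{g}$ of dimension $n \geq 4$, a frame $\{X_1,\ldots,X_n\}$ is called a Milnor frame if there exist $\lambda_1,\ldots,\lambda_n \in \mathbb{R}$ (the structure constants of the frame, possibly zero) such that, with all indices taken modulo $n$, for all $i,j$: $[X_i,X_j] = \lambda_{i+2}X_{i+2}$ if $j = i+1$; $[X_i,X_j] = -\lambda_{j+2}X_{j+2}$ if $i = j+1$; and $[X_i,X_j]=0$ otherwise. $\mathfrak{h}^3$ is the 3-dimensional Heisenberg Lie algebra: it has a basis $X_1,X_2,X_3$ with $[X_1,X_2]=X_3$ and all other brackets of basis elements (up to antisymmetry) zero. $\mathfrak{h}^4$ is the 4-dimensional Lie algebra with a basis $X_1,X_2,X_3,X_4$ such that $[X_1,X_2]=X_3$, $[X_2,X_3]=X_4$ and all other brackets of basis elements (up to antisymmetry) are zero. *)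

(* Defs.v *)
From HB Require Import structures.
From mathcomp Require Import all_boot all_order all_algebra.
From mathcomp Require Import reals.
From mathcomp Require Import ring.

Set Implicit Arguments.
Unset Strict Implicit.
Unset Printing Implicit Defensive.

Import GRing.Theory.

Local Open Scope ring_scope.

HB.mixin Record isLieAlgebra (F : fieldType) g of Vector F g := {
  bracket : g -> g -> g;
  bracket_linearl : forall (a : F) (x y z : g),
    bracket (a *: x + y) z = a *: bracket x z + bracket y z;
  bracket_linearr : forall (a : F) (z x y : g),
    bracket z (a *: x + y) = a *: bracket z x + bracket z y;
  bracketxx : forall x : g, bracket x x = 0;
  bracket_jacobi : forall x y z : g,
    bracket x (bracket y z) + bracket y (bracket z x)
      + bracket z (bracket x y) = 0
}.

#[short(type="lieAlgType")]
HB.structure Definition LieAlgebra (F : fieldType) :=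
  { g of isLieAlgebra F g & Vector F g }.

Notation "[ 'lie' x , y ]" := (bracket x y)
  (at level 0, x, y at level 99, format "[ 'lie'  x ,  y ]") : ring_scope.

Section Direct_sums.

Variable F : fieldType.

Section Pair.
Variables g h : lieAlgType F.

Definition pair_bracket (x y : g * h) : g * h :=
  ([lie x.1, y.1], [lie x.2, y.2]).

Fact pair_bracket_linearl (a : F) (x y z : g * h) :
  pair_bracket (a *: x + y) z = a *: pair_bracket x z + pair_bracket y z.
Proof. by congr (_, _); rewrite /= bracket_linearl. Qed.

Fact pair_bracket_linearr (a : F) (z x y : g * h) :
  pair_bracket z (a *: x + y) = a *: pair_bracket z x + pair_bracket z y.
Proof. by congr (_, _); rewrite /= bracket_linearr. Qed.

Fact pair_bracketxx (x : g * h) : pair_bracket x x = 0.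
Proof. by rewrite /pair_bracket !bracketxx. Qed.

Fact pair_bracket_jacobi (x y z : g * h) :
  pair_bracket x (pair_bracket y z) + pair_bracket y (pair_bracket z x)
    + pair_bracket z (pair_bracket x y) = 0.
Proof. by congr (_, _); rewrite /= bracket_jacobi. Qed.

HB.instance Definition _ := isLieAlgebra.Build F (g * h)%type
  pair_bracket_linearl pair_bracket_linearr pair_bracketxx pair_bracket_jacobi.
End Pair.

Section Power.
Variables (I : finType) (g : lieAlgType F).

Definition ffun_bracket (x y : {ffun I -> g}) : {ffun I -> g} :=
  [ffun i => [lie x i, y i]].

Fact ffun_bracket_linearl (a : F) (x y z : {ffun I -> g}) :
  ffun_bracket (a *: x + y) z = a *: ffun_bracket x z + ffun_bracket y z.
Proof. by apply/ffunP => i; rewrite !ffunE bracket_linearl. Qed.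

Fact ffun_bracket_linearr (a : F) (z x y : {ffun I -> g}) :
  ffun_bracket z (a *: x + y) = a *: ffun_bracket z x + ffun_bracket z y.
Proof. by apply/ffunP => i; rewrite !ffunE bracket_linearr. Qed.

Fact ffun_bracketxx (x : {ffun I -> g}) : ffun_bracket x x = 0.
Proof. by apply/ffunP => i; rewrite !ffunE bracketxx. Qed.

Fact ffun_bracket_jacobi (x y z : {ffun I -> g}) :
  ffun_bracket x (ffun_bracket y z) + ffun_bracket y (ffun_bracket z x)
    + ffun_bracket z (ffun_bracket x y) = 0.
Proof. by apply/ffunP => i; rewrite !ffunE bracket_jacobi. Qed.

HB.instance Definition _ := isLieAlgebra.Build F {ffun I -> g}
  ffun_bracket_linearl ffun_bracket_linearr ffun_bracketxx ffun_bracket_jacobi.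
End Power.

End Direct_sums.

Section Lie_notions.

Variable F : fieldType.

Definition lie_abelian (g : lieAlgType F) : Prop :=
  forall x y : g, [lie x, y] = 0.

Definition lie_isomorphic (g h : lieAlgType F) : Prop :=
  exists f : {linear g -> h},
    bijective f /\ forall x y : g, f [lie x, y] = [lie f x, f y].

(* The subspace [U, V]; brackets of basis vectors suffice by bilinearity, as
   lie_prodP makes explicit. *)
Definition lie_prod (g : lieAlgType F) (U V : {vspace g}) : {vspace g} :=
  <<[seq [lie u, v] | u <- vbasis U, v <- vbasis V]>>%VS.

Lemma lie_prodP (g : lieAlgType F) (U V W : {vspace g}) :
  reflect (forall u v, u \in U -> v \in V -> [lie u, v] \in W)
          (lie_prod U V <= W)%VS.
Proof.
have suml n (a : 'I_n -> F) (s : 'I_n -> g) z :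
    [lie \sum_i a i *: s i, z] = \sum_i a i *: [lie s i, z].
  elim: n a s => [|n IH] a s; last first.
    by rewrite !big_ord_recl bracket_linearl IH.
  have := bracket_linearl (-1) (0 : g) 0 z.
  by rewrite !big_ord0 scaler0 addr0 scaleN1r addNr.
have sumr n (a : 'I_n -> F) (s : 'I_n -> g) z :
    [lie z, \sum_i a i *: s i] = \sum_i a i *: [lie z, s i].
  elim: n a s => [|n IH] a s; last first.
    by rewrite !big_ord_recl bracket_linearr IH.
  have := bracket_linearr (-1) z (0 : g) 0.
  by rewrite !big_ord0 scaler0 addr0 scaleN1r addNr.
apply: (iffP idP) => [sUVW u v uU vV | UVW].
  rewrite (coord_vbasis uU) suml; apply: memv_suml => i _.
  rewrite (coord_vbasis vV) sumr; apply/memvZ/memv_suml => j _.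
  apply/memvZ/(subvP sUVW)/memv_span/allpairsP.
  by exists ((vbasis U)`_i, (vbasis V)`_j); rewrite !mem_nth ?size_tuple.
apply/span_subvP => _ /allpairsP[[u v] /= [uU vV ->]].
by apply: UVW; apply: vbasis_mem.
Qed.

(* Indices are taken in 'I_n = {0, ..., n-1}; ordS is i |-> i + 1 modulo n. *)
Definition milnor_frame (g : lieAlgType F) (n : nat) (X : n.-tuple g) : Prop :=
  basis_of fullv X /\
  exists lambda : 'I_n -> F, forall i j : 'I_n,
    [/\ j = ordS i ->
          [lie tnth X i, tnth X j]
            = lambda (ordS (ordS i)) *: tnth X (ordS (ordS i)),
        i = ordS j ->
          [lie tnth X i, tnth X j]
            = - (lambda (ordS (ordS j)) *: tnth X (ordS (ordS j)))
      & j <> ordS i -> i <> ordS j -> [lie tnth X i, tnth X j] = 0].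

End Lie_notions.

(* The basis X_1, X_2, ... of h^3 and h^4 is delta_mx 0 0, delta_mx 0 1, ...;
   see heis3_basis and heis4_basis. *)
Definition heis3 (F : fieldType) := 'rV[F]_3.
Definition heis4 (F : fieldType) := 'rV[F]_4.

HB.instance Definition _ (F : fieldType) := Vector.on (heis3 F).
HB.instance Definition _ (F : fieldType) := Vector.on (heis4 F).

Section Heisenberg.

Variable F : fieldType.

Definition heis3_bracket (x y : heis3 F) : heis3 F :=
  (x 0 0 * y 0 1 - x 0 1 * y 0 0) *: delta_mx 0 2.

Definition heis4_bracket (x y : heis4 F) : heis4 F :=
  (x 0 0 * y 0 1 - x 0 1 * y 0 0) *: delta_mx 0 2
  + (x 0 1 * y 0 2 - x 0 2 * y 0 1) *: delta_mx 0 3.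

Fact heis3_linearl (a : F) (x y z : heis3 F) :
  heis3_bracket (a *: x + y) z = a *: heis3_bracket x z + heis3_bracket y z.
Proof. by apply/rowP => k; rewrite !mxE; ring. Qed.

Fact heis3_linearr (a : F) (z x y : heis3 F) :
  heis3_bracket z (a *: x + y) = a *: heis3_bracket z x + heis3_bracket z y.
Proof. by apply/rowP => k; rewrite !mxE; ring. Qed.

Fact heis3_xx (x : heis3 F) : heis3_bracket x x = 0.
Proof. by apply/rowP => k; rewrite !mxE; ring. Qed.

Fact heis3_jacobi (x y z : heis3 F) :
  heis3_bracket x (heis3_bracket y z) + heis3_bracket y (heis3_bracket z x)
    + heis3_bracket z (heis3_bracket x y) = 0.
Proof. by apply/rowP => k; rewrite !mxE /=; ring. Qed.

HB.instance Definition _ := isLieAlgebra.Build F (heis3 F)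
  heis3_linearl heis3_linearr heis3_xx heis3_jacobi.

Fact heis4_linearl (a : F) (x y z : heis4 F) :
  heis4_bracket (a *: x + y) z = a *: heis4_bracket x z + heis4_bracket y z.
Proof. by apply/rowP => k; rewrite !mxE; ring. Qed.

Fact heis4_linearr (a : F) (z x y : heis4 F) :
  heis4_bracket z (a *: x + y) = a *: heis4_bracket z x + heis4_bracket z y.
Proof. by apply/rowP => k; rewrite !mxE; ring. Qed.

Fact heis4_xx (x : heis4 F) : heis4_bracket x x = 0.
Proof. by apply/rowP => k; rewrite !mxE; ring. Qed.

Fact heis4_jacobi (x y z : heis4 F) :
  heis4_bracket x (heis4_bracket y z) + heis4_bracket y (heis4_bracket z x)
    + heis4_bracket z (heis4_bracket x y) = 0.
Proof. by apply/rowP => k; rewrite !mxE /=; ring. Qed.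

HB.instance Definition _ := isLieAlgebra.Build F (heis4 F)
  heis4_linearl heis4_linearr heis4_xx heis4_jacobi.

Lemma heis3_basis (X := fun i => delta_mx 0 i : heis3 F) :
  [/\ [lie X 0, X 1] = X 2, [lie X 0, X 2] = 0 & [lie X 1, X 2] = 0].
Proof. by split; apply/rowP => k; rewrite !mxE /=; ring. Qed.

Lemma heis4_basis (X := fun i => delta_mx 0 i : heis4 F) :
  [/\ [lie X 0, X 1] = X 2, [lie X 1, X 2] = X 3
    & [/\ [lie X 0, X 2] = 0, [lie X 0, X 3] = 0,
          [lie X 1, X 3] = 0 & [lie X 2, X 3] = 0]].
Proof. by do 2?split; apply/rowP => k; rewrite !mxE /=; ring. Qed.

End Heisenberg.

(* Main.v *)
Require Import Defs.
From HB Require Import structures.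
From mathcomp Require Import all_boot all_order all_algebra.
From mathcomp Require Import reals.
From mathcomp Require Import ring.

Set Implicit Arguments.
Unset Strict Implicit.
Unset Printing Implicit Defensive.

Import GRing.Theory.

Local Open Scope ring_scope.

(** Let [sigma] be the successor on indices modulo [n] and [x_ i] the [i]-th
    coordinate in the Milnor frame. Everything follows from two facts.

    The Jacobi identity for [X_i], [X_(i+1)], [X_(i+3)] gives
    [lambda_k * lambda_(k+2) = 0] for every [k] ([lambda_sparse]). So the
    support [s] of [lambda] never contains both [k] and [k+2], and its cyclic
    runs have length one or two. A run [{k}] gives a copy of [h^3] on
    [X_(k-2), X_(k-1), X_k], and a run [{k, k+1}] gives a copy of [h^4] on
    [X_(k-2), ..., X_(k+1)]; the frame vectors left over span an abelian
    summand. Any two of these blocks are disjoint, because a run is followed by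
    at least two indices outside the support.

    The second fact is the coordinate formula
    [x_(l+2) [x, y] = lambda_(l+2) * (x_l y_(l+1) - x_(l+1) y_l)]
    ([coord_bracket]). Hence sending [x] to its suitably rescaled block
    coordinates respects brackets: the coordinates at the two starting indices
    of a block vanish on brackets, and each of the others only involves
    coordinates of the same block.

    Neither disjointness of the blocks nor an inverse of this map is worked out.
    Both are replaced by the identity [blocks_cover_once], which says that an
    index lies in exactly one block. It depends on five consecutive values of
    the indicator of [s], so it is a finite check. At one index, it gives
    injectivity; summed over all indices, it gives
    [3 p + 4 q + dim a = n] ([card_blocks]), so that the injective map is
    bijective.

    Nilpotency is read off the same formula. On [[g, g]] the coordinates outside
    the support vanish. On [[g, [g, g]]] coordinate [k] also vanishes unless
    both [k] and [k-1] are in the support. One more bracket would need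
    both [k] and [k-2] in the support, which sparsity forbids. *)

(** * Bilinearity of the bracket *)

Section Bracket.
Variables (F : fieldType) (g : lieAlgType F).
Implicit Types x y z : g.

HB.instance Definition _ z := GRing.isLinear.Build F g g *:%R (bracket z)
  (fun a x y => bracket_linearr a z x y).

(** The bracket with its arguments exchanged, so that linearity in the left
    argument can be registered as a structure of linear map. *)
Definition bracketr z x : g := [lie x, z].

HB.instance Definition _ z := GRing.isLinear.Build F g g *:%R (bracketr z)
  (fun a x y => bracket_linearl a x y z).

Lemma bracket_suml (I : finType) (f : I -> g) z :
  [lie \sum_i f i, z] = \sum_i [lie f i, z].
Proof. exact: (linear_sum (bracketr z)). Qed.

Lemma bracketZl a x z : [lie a *: x, z] = a *: [lie x, z].
Proof. exact: (linearZ_LR (bracketr z)). Qed.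

(** The kernel of a linear form is a subspace, so vanishing on brackets passes
    to their span: this allows computing in [lie_prod] one coordinate at a
    time. *)
Lemma scalar_lie_prod0 (phi : {scalar g}) (U V : {vspace g}) :
    (forall u v, u \in U -> v \in V -> phi [lie u, v] = 0) ->
  forall w, w \in lie_prod U V -> phi w = 0.
Proof.
move=> phi0 w UVw; pose f : 'Hom(g, F^o) := linfun (phi : {linear g -> F^o}).
suff /subvP/(_ w UVw): (lie_prod U V <= lker f)%VS.
  by rewrite memv_ker lfunE => /eqP.
by apply/lie_prodP => u v Uu Vv; rewrite memv_ker lfunE /= phi0.
Qed.

End Bracket.

(** * Cyclic indices *)

Lemma val_iter_ordS n (i : 'I_n) k :
  iter k (@ordS n) i = ((i + k) %% n)%N :> nat.
Proof.
elim: k => [|k IH]; first by rewrite addn0 modn_small.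
by rewrite iterS /= IH -addn1 modnDml addn1 addnS.
Qed.

Lemma iter_ordS_neq n (i : 'I_n) k : (0 < k < n)%N -> iter k (@ordS n) i != i.
Proof.
move=> /andP[k_gt0 k_ltn]; apply/eqP => /(congr1 val)/=.
rewrite val_iter_ordS -{2}(modn_small (ltn_ord i)) -[X in _ = (X %% _)%N]addn0.
move=> /eqP; rewrite eqn_modDl mod0n modn_small //.
by rewrite (gtn_eqF k_gt0).
Qed.

Section Blocks.
Variables (I : finType) (sigma : I -> I) (s : pred I).
Hypothesis sigma_inj : injective sigma.
Hypothesis s_sparse : forall i, ~~ (s i && s (sigma (sigma i))).

(** A block is named by its smallest index [i], which is two below the first
    element of its run in the support. *)
Definition heis3_start i :=
  [&& ~~ s (sigma i), s (sigma (sigma i)) & ~~ s (sigma (sigma (sigma i)))].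

Definition heis4_start i :=
  s (sigma (sigma i)) && s (sigma (sigma (sigma i))).

Definition idle i := [&& ~~ s i, ~~ s (sigma i) & ~~ s (sigma (sigma i))].

(** Index [l] lies in the [h^3] blocks that start at [l-2], [l-1], [l] and in
    the [h^4] blocks that start at [l-3], ..., [l]. Starting from [i = l - 3]
    avoids the predecessor function. Only the values of [s] at [l-1], ...,
    [l+3] occur, so the three relevant instances of sparsity leave a finite
    number of cases. *)
Lemma blocks_cover_once i (j := sigma i) (k := sigma j) (l := sigma k) :
  (heis3_start j + heis3_start k + heis3_start l
   + (heis4_start i + heis4_start j + heis4_start k + heis4_start l)
   + idle l = 1)%N.
Proof.
rewrite /heis3_start /heis4_start /idle -/j -/k -/l.
move: (s_sparse k) (s_sparse l) (s_sparse (sigma l)).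
rewrite -/k -/l.
by do ![case: (s _) => //=].
Qed.

(** Summing [blocks_cover_once] over all indices counts each block once for
    every one of its elements, since each shift permutes the index set. *)
Lemma card_blocks :
  (#|heis3_start| * 3 + #|heis4_start| * 4 + #|idle| = #|I|)%N.
Proof.
have count (P : pred I) : #|P| = (\sum_i P i)%N.
  rewrite -sum1_card big_mkcond; apply: eq_bigr => i _.
  by rewrite unfold_in; case: (P i).
have shift (P : pred I) : #|P| = (\sum_i P (sigma i))%N.
  by rewrite count (reindex_inj sigma_inj).
have shift2 (P : pred I) : #|P| = (\sum_i P (sigma (sigma i)))%N.
  by rewrite shift (reindex_inj sigma_inj).
have shift3 (P : pred I) : #|P| = (\sum_i P (sigma (sigma (sigma i))))%N.
  by rewrite shift2 (reindex_inj sigma_inj).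
have -> : #|I| = (\sum_(i : I) 1)%N by rewrite sum1_card.
rewrite -(eq_bigr _ (fun i _ => blocks_cover_once i)) !big_split /=.
rewrite -(shift heis3_start) -(shift2 heis3_start) -(shift3 heis3_start).
rewrite -(count heis4_start) -(shift heis4_start) -(shift2 heis4_start).
by rewrite -(shift3 heis4_start) -(shift3 idle); ring.
Qed.

End Blocks.

(** * Abelian algebras and linear bijections *)

Definition abelian_alg (F : fieldType) (m : nat) := 'rV[F]_m.

HB.instance Definition _ F m := Vector.on (abelian_alg F m).

Section AbelianAlgebra.
Variables (F : fieldType) (m : nat).

Definition zero_bracket (x y : abelian_alg F m) : abelian_alg F m := 0.

Fact zero_bracket_linearl (a : F) x y z :
  zero_bracket (a *: x + y) z = a *: zero_bracket x z + zero_bracket y z.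
Proof. by rewrite scaler0 addr0. Qed.

Fact zero_bracket_linearr (a : F) z x y :
  zero_bracket z (a *: x + y) = a *: zero_bracket z x + zero_bracket z y.
Proof. by rewrite scaler0 addr0. Qed.

Fact zero_bracketxx x : zero_bracket x x = 0.
Proof. by []. Qed.

Fact zero_bracket_jacobi x y z :
  zero_bracket x (zero_bracket y z) + zero_bracket y (zero_bracket z x)
    + zero_bracket z (zero_bracket x y) = 0.
Proof. by rewrite !addr0. Qed.

HB.instance Definition _ := isLieAlgebra.Build F (abelian_alg F m)
  zero_bracket_linearl zero_bracket_linearr zero_bracketxx zero_bracket_jacobi.

Lemma abelian_algP : lie_abelian (abelian_alg F m).
Proof. by []. Qed.

End AbelianAlgebra.

Lemma linear_inj_bij (F : fieldType) (U V : vectType F) (f : {linear U -> V}) :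
  \dim {:U} = \dim {:V} -> injective f -> bijective f.
Proof.
move=> dimUV f_inj; pose h := linfun f.
have ker0 : lker h == 0%VS by apply/lker0P => x y; rewrite !lfunE; apply: f_inj.
have limT : limg h = fullv.
  apply/eqP; rewrite eqEdim subvf -dimUV limg_dim_eq ?leqnn //.
  by rewrite (eqP ker0) capv0.
exists (h^-1)%VF => [x|y]; first by rewrite -[f x](lfunE f) lker0_lfunK.
by rewrite -[LHS](lfunE f) limg_lfunVK // limT memvf.
Qed.

(** * The bracket in a Milnor frame *)

Section MilnorFrame.
Variables (F : fieldType) (g : lieAlgType F) (n : nat) (X : n.-tuple g).
Variable lambda : 'I_n -> F.
Hypothesis n_ge4 : (4 <= n)%N.
Hypothesis X_basis : basis_of fullv X.
Hypothesis X_bracket : forall i j : 'I_n,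
  [/\ j = ordS i ->
        [lie tnth X i, tnth X j]
          = lambda (ordS (ordS i)) *: tnth X (ordS (ordS i)),
      i = ordS j ->
        [lie tnth X i, tnth X j]
          = - (lambda (ordS (ordS j)) *: tnth X (ordS (ordS j)))
    & j <> ordS i -> i <> ordS j -> [lie tnth X i, tnth X j] = 0].

Local Notation sigma := (@ordS n).
Local Notation x_ i x := (coord X i x).

Let sigma1_neq i : sigma i != i.
Proof. by apply: (@iter_ordS_neq n i 1); rewrite (ltn_trans _ n_ge4). Qed.

Let sigma2_neq i : sigma (sigma i) != i.
Proof. by apply: (@iter_ordS_neq n i 2); rewrite (ltn_trans _ n_ge4). Qed.

Let sigma3_neq i : sigma (sigma (sigma i)) != i.
Proof. exact: (@iter_ordS_neq n i 3). Qed.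

Lemma frame_bracketE i j : [lie tnth X i, tnth X j] =
  (j == sigma i)%:R *: (lambda (sigma (sigma i)) *: tnth X (sigma (sigma i)))
  - (i == sigma j)%:R *: (lambda (sigma (sigma j)) *: tnth X (sigma (sigma j))).
Proof.
have [Hup Hdown H0] := X_bracket i j.
have [ji|/eqP nji] := eqVneq j (sigma i).
  by rewrite Hup // ji eq_sym (negPf (sigma2_neq i)) scale1r scale0r subr0.
have [ij|/eqP nij] := eqVneq i (sigma j).
  by rewrite Hdown // scale1r scale0r sub0r.
by rewrite H0 // !scale0r subr0.
Qed.

Lemma coord_frame i j : x_ i (tnth X j) = (j == i)%:R.
Proof. by rewrite (tnth_nth 0) coord_free // (basis_free X_basis). Qed.

Lemma frame_sum x : x = \sum_i x_ i x *: tnth X i.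
Proof.
rewrite {1}(coord_basis X_basis (memvf x)).
by apply: eq_bigr => i _; rewrite (tnth_nth 0).
Qed.

Lemma coord_inj x y : (forall i, x_ i x = x_ i y) -> x = y.
Proof.
move=> xy; rewrite (frame_sum x) (frame_sum y).
by apply: eq_bigr => i _; rewrite xy.
Qed.

Lemma sum_pick (j : 'I_n) (f : 'I_n -> F) : \sum_i (i == j)%:R * f i = f j.
Proof.
rewrite (bigD1 j) //= eqxx mul1r big1 ?addr0 // => i /negPf->.
by rewrite mul0r.
Qed.

(** Only the pairs [(l, l+1)] and [(l+1, l)] of frame vectors have a bracket
    with a component along [X_(l+2)]. *)
Lemma coord_bracket l x y : x_ (sigma (sigma l)) [lie x, y] =
  lambda (sigma (sigma l)) * (x_ l x * x_ (sigma l) y - x_ (sigma l) x * x_ l y).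
Proof.
set k := sigma (sigma l).
have -> : [lie x, y] =
    \sum_i \sum_j (x_ i x * x_ j y) *: [lie tnth X i, tnth X j].
  rewrite {1}(frame_sum x) bracket_suml; apply: eq_bigr => i _.
  rewrite bracketZl {1}(frame_sum y) linear_sum scaler_sumr.
  by apply: eq_bigr => j _; rewrite linearZ /= scalerA.
(* The contributions of the two orders of a pair of adjacent indices. *)
pose a i j := (i == l)%:R * ((j == sigma i)%:R * (lambda k * x_ i x * x_ j y)).
pose b i j := (j == l)%:R * ((i == sigma j)%:R * (lambda k * x_ i x * x_ j y)).
transitivity (\sum_i \sum_j (a i j - b i j)).
  rewrite linear_sum; apply: eq_bigr => i _.
  rewrite linear_sum; apply: eq_bigr => j _.
  rewrite frame_bracketE linearZ linearB !linearZ /= !coord_frame /a /b /k.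
  rewrite !(inj_eq (@ordS_inj n)) /GRing.scale /=.
  by have [->|_] := eqVneq i l; have [->|_] := eqVneq j l;
    rewrite /= ?mulr1n ?mulr0n; ring.
under eq_bigr => i _ do rewrite sumrB.
rewrite sumrB [X in _ - X]exchange_big /= /a /b.
under eq_bigr => i _ do rewrite -mulr_sumr sum_pick.
under [X in _ - X]eq_bigr => i _ do rewrite -mulr_sumr sum_pick.
by rewrite !sum_pick; ring.
Qed.

(** The constraint that the Jacobi identity puts on the structure constants. *)
Lemma lambda_sparse i : lambda i * lambda (sigma (sigma i)) = 0.
Proof.
have [pred _ predK] := ordS_bij n.
rewrite -(predK i) -(predK (pred i)).
set a := pred (pred i); set b := sigma a; set c := sigma b; set d := sigma c.
have ba : [lie tnth X a, tnth X b] = lambda c *: tnth X c.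
  by have [-> //] := X_bracket a b.
have cd : [lie tnth X d, tnth X c] = - (lambda (sigma d) *: tnth X (sigma d)).
  by have [_ -> //] := X_bracket d c.
have bd : [lie tnth X b, tnth X d] = 0.
  have [_ _ -> //] := X_bracket b d; apply/eqP; first exact: sigma1_neq.
  by rewrite eq_sym (sigma3_neq b).
(* The inner bracket is nonzero only if [n = 4], when [X_d] and [X_a] are
   adjacent; it is then proportional to [X_b], which commutes with itself. *)
have bda : [lie tnth X b, [lie tnth X d, tnth X a]] = 0.
  rewrite frame_bracketE [d == _](negPf (sigma2_neq b)) scale0r subr0.
  have [<-|_] := eqVneq a (sigma d); last by rewrite scale0r linear0.
  by rewrite -/b !linearZ /= bracketxx !scaler0.
have := bracket_jacobi (tnth X a) (tnth X b) (tnth X d).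
rewrite bd bda linear0 !add0r ba linearZ /= cd => /(congr1 (coord X (sigma d))).
rewrite scalerN linearN !linearZ /= linear0 coord_frame eqxx /GRing.scale /=.
by rewrite mulr1 => /eqP; rewrite oppr_eq0 => /eqP.
Qed.

Let s i := lambda i != 0.

Lemma lambda_support_sparse i : ~~ (s i && s (sigma (sigma i))).
Proof. by rewrite -negb_or -mulf_eq0 lambda_sparse eqxx. Qed.

Lemma coord_bracket0 k x y : lambda k = 0 -> x_ k [lie x, y] = 0.
Proof.
have [pred _ predK] := ordS_bij n.
rewrite -(predK k) -(predK (pred k)) => lambda0.
by rewrite coord_bracket lambda0 mul0r.
Qed.

(** * Coordinates adapted to the blocks *)

(** The divisions absorb the structure constants: [lambda l *: X_l] and, in an
    [h^4] block, [(lambda l * lambda m) *: X_m] are the frame vectors rescaled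
    so that all brackets have coefficient one. *)
Definition heis3_part j x : heis3 F :=
  let k := sigma j in let l := sigma k in
  \row_i [:: x_ j x; x_ k x; x_ l x / lambda l]`_i.

Definition heis4_part j x : heis4 F :=
  let k := sigma j in let l := sigma k in let m := sigma l in
  \row_i [:: x_ j x; x_ k x; x_ l x / lambda l;
             x_ m x / (lambda l * lambda m)]`_i.

Definition block_coords x :
    {ffun 'I_#|heis3_start sigma s| -> heis3 F}
    * {ffun 'I_#|heis4_start sigma s| -> heis4 F}
    * abelian_alg F #|idle sigma s| :=
  ([ffun j => heis3_part (enum_val j) x],
   [ffun j => heis4_part (enum_val j) x],
   \row_c x_ (enum_val c) x).

Fact block_coords_linear : linear block_coords.
Proof.
move=> a x y; congr (_, _, _).
- apply/ffunP => j; rewrite !ffunE; apply/rowP => i; rewrite !mxE.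
  by case: i => [[|[|[|[]]]] ?] //=; rewrite linearP //= /GRing.scale /=; ring.
- apply/ffunP => j; rewrite !ffunE; apply/rowP => i; rewrite !mxE.
  case: i => [[|[|[|[|[]]]]] ?] //=;
    by rewrite linearP //= /GRing.scale /=; ring.
- by apply/rowP => c; rewrite !mxE linearP.
Qed.

HB.instance Definition _ := GRing.isLinear.Build F g _ *:%R block_coords
  block_coords_linear.

(** The first two coordinates vanish on both sides: a start [j] has [lambda]
    zero at [j] and at [j+1]. Sparsity yields one of these zeros here and both
    in [heis4_part_bracket]. *)
Lemma heis3_part_bracket j x y : heis3_start sigma s j ->
  heis3_part j [lie x, y] = [lie heis3_part j x, heis3_part j y].
Proof.
case/and3P=> /negPn/eqP k0 l_neq0 _.
have j0 : lambda j = 0.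
  by have := lambda_support_sparse j; rewrite l_neq0 andbT => /negPn/eqP.
apply/rowP => i; rewrite !mxE.
case: i => [[|[|[|[]]]] ?] //=;
  rewrite ?(coord_bracket0 _ _ j0) ?(coord_bracket0 _ _ k0) ?coord_bracket.
- by rewrite mulr0.
- by rewrite mulr0.
- by rewrite mulr1 mulrAC mulfV // mul1r.
Qed.

Lemma heis4_part_bracket j x y : heis4_start sigma s j ->
  heis4_part j [lie x, y] = [lie heis4_part j x, heis4_part j y].
Proof.
case/andP=> l_neq0 m_neq0.
have j0 : lambda j = 0.
  by have := lambda_support_sparse j; rewrite l_neq0 andbT => /negPn/eqP.
have k0 : lambda (sigma j) = 0.
  have := lambda_support_sparse (sigma j).
  by rewrite m_neq0 andbT => /negPn/eqP.
rewrite /s in l_neq0 m_neq0.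
apply/rowP => i; rewrite !mxE.
case: i => [[|[|[|[|[]]]]] ?] //=;
  rewrite ?(coord_bracket0 _ _ j0) ?(coord_bracket0 _ _ k0) ?coord_bracket //.
- by ring.
- by ring.
- by field.
- by field; apply/andP.
Qed.

Lemma block_coords_bracket x y :
  block_coords [lie x, y] = [lie block_coords x, block_coords y].
Proof.
congr (_, _, _).
- apply/ffunP => j; rewrite !ffunE heis3_part_bracket //.
  exact: (enum_valP j).
- apply/ffunP => j; rewrite !ffunE heis4_part_bracket //.
  exact: (enum_valP j).
- apply/rowP => c; rewrite !mxE coord_bracket0 //.
  by have /and3P[/negPn/eqP] := enum_valP c.
Qed.

(** Each coordinate can be recovered from the block that contains its index. *)
Lemma block_coords_inj : injective block_coords.
Proof.
move=> x y [/ffunP xy3 /ffunP xy4 /rowP xy1]; apply: coord_inj => i.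
have h3 j : heis3_start sigma s j -> [/\ x_ j x = x_ j y,
    x_ (sigma j) x = x_ (sigma j) y
    & x_ (sigma (sigma j)) x = x_ (sigma (sigma j)) y].
  move=> Aj; have /rowP xyj := xy3 (enum_rank_in Aj j).
  move: xyj; rewrite !ffunE enum_rankK_in // => xyj.
  split; first by have := xyj 0; rewrite !mxE.
    by have := xyj 1; rewrite !mxE.
  case/and3P: Aj => _ l_neq0 _.
  by have := xyj 2; rewrite !mxE /=; apply/mulIf/invr_neq0.
have h4 j : heis4_start sigma s j -> [/\ x_ j x = x_ j y,
    x_ (sigma j) x = x_ (sigma j) y,
    x_ (sigma (sigma j)) x = x_ (sigma (sigma j)) y
    & x_ (sigma (sigma (sigma j))) x = x_ (sigma (sigma (sigma j))) y].
  move=> Bj; have /rowP xyj := xy4 (enum_rank_in Bj j).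
  move: xyj; rewrite !ffunE enum_rankK_in // => xyj.
  case/andP: Bj => l_neq0 m_neq0.
  split; first by have := xyj 0; rewrite !mxE.
  - by have := xyj 1; rewrite !mxE.
  - by have := xyj 2; rewrite !mxE /=; apply/mulIf/invr_neq0.
  - by have := xyj 3; rewrite !mxE /=; apply/mulIf/invr_neq0/mulf_neq0.
have h1 c : idle sigma s c -> x_ c x = x_ c y.
  by move=> Cc; have := xy1 (enum_rank_in Cc c); rewrite !mxE enum_rankK_in.
have [pred _ predK] := ordS_bij n.
rewrite -(predK i) -(predK (pred i)) -(predK (pred (pred i))).
have := blocks_cover_once lambda_support_sparse (pred (pred (pred i))).
set j := pred _; cbv zeta.
have [/h3[] //|_] := boolP (heis3_start sigma s (sigma j)).
have [/h3[] //|_] := boolP (heis3_start sigma s (sigma (sigma j))).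
have [/h3[] //|_] := boolP (heis3_start sigma s (sigma (sigma (sigma j)))).
have [/h4[] //|_] := boolP (heis4_start sigma s j).
have [/h4[] //|_] := boolP (heis4_start sigma s (sigma j)).
have [/h4[] //|_] := boolP (heis4_start sigma s (sigma (sigma j))).
have [/h4[] //|_] := boolP (heis4_start sigma s (sigma (sigma (sigma j)))).
by have [/h1 //|_] := boolP (idle sigma s (sigma (sigma (sigma j)))).
Qed.

Lemma milnor_decomposition :
  exists (p q : nat) (a : lieAlgType F), lie_abelian a /\
    lie_isomorphic g ({ffun 'I_p -> heis3 F} * {ffun 'I_q -> heis4 F} * a)%type.
Proof.
exists #|heis3_start sigma s|, #|heis4_start sigma s|,
  (abelian_alg F #|idle sigma s|).
split; first exact: abelian_algP.
exists block_coords; split; last exact: block_coords_bracket.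
apply: linear_inj_bij block_coords_inj.
have dim_g : \dim {:g} = n by rewrite -(size_basis X_basis).
rewrite dim_g dimvf.
(* The dimension of a product of function and row spaces, by conversion. *)
transitivity (#|'I_#|heis3_start sigma s| | * (1 * 3)
   + #|'I_#|heis4_start sigma s| | * (1 * 4) + 1 * #|idle sigma s|)%N;
  last by [].
rewrite !card_ord !mul1n.
by rewrite (card_blocks (@ordS_inj n) lambda_support_sparse) card_ord.
Qed.

(** * Nilpotency *)

Lemma milnor_3step_nilpotent :
  lie_prod fullv (lie_prod fullv (lie_prod fullv {:g})) = 0%VS.
Proof.
have [pred _ predK] := ordS_bij n.
have D1 z : z \in lie_prod fullv {:g} -> forall k, lambda k = 0 -> x_ k z = 0.
  move=> D1z k k0; move: z D1z; apply: scalar_lie_prod0 => u v _ _ /=.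
  exact: coord_bracket0.
have D2 z : z \in lie_prod fullv (lie_prod fullv {:g}) ->
    forall k, lambda (sigma k) = 0 \/ lambda k = 0 -> x_ (sigma k) z = 0.
  move=> D2z k k0; move: z D2z; apply: scalar_lie_prod0 => u v _ D1v /=.
  have [l1_0|l1_neq0] := eqVneq (lambda (sigma k)) 0.
    exact: coord_bracket0.
  case: k0 => [/eqP|k0]; first by rewrite (negPf l1_neq0).
  (* As [k+1] is in the support, [k-1] is not, so [v_(k-1)] is zero, and [v_k]
     is zero because [lambda k] is. *)
  move: l1_neq0; rewrite -(predK k) => m_neq0.
  have pred_k0 : lambda (pred k) = 0.
    have := lambda_support_sparse (pred k).
    by rewrite [s (sigma _)]m_neq0 andbT => /negPn/eqP.
  rewrite coord_bracket (D1 v D1v _ pred_k0) (D1 v D1v) ?predK //.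
  by rewrite !mulr0 subr0 mulr0.
apply/eqP; rewrite -subv0; apply/subvP => w; rewrite memv0 => D3w.
apply/eqP/coord_inj => i; rewrite linear0.
move: w D3w; apply: scalar_lie_prod0 => u v _ D2v /=.
have [i0|i_neq0] := eqVneq (lambda i) 0; first exact: coord_bracket0.
move: i_neq0; rewrite -(predK i) -(predK (pred i)) -(predK (pred (pred i))).
set j := pred (pred (pred i)) => i_neq0.
(* As [j+3] is in the support, [j+1] is not, so [v_(j+1)] and [v_(j+2)] are
   zero. *)
have k0 : lambda (sigma j) = 0.
  have := lambda_support_sparse (sigma j).
  by rewrite [s (sigma (sigma _))]i_neq0 andbT => /negPn/eqP.
rewrite coord_bracket (D2 v D2v); last by right.
by rewrite (D2 v D2v) ?mulr0 ?subr0 ?mulr0 //; left.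
Qed.

End MilnorFrame.

Theorem theorem1p3 (R : realType) (n : nat) (g : lieAlgType R)
    (dim_g : \dim (fullv : {vspace g}) = n) (n_ge4 : (4 <= n)%N)
    (milnor_g : exists X : n.-tuple g, milnor_frame X) :
  (exists (p q : nat) (a : lieAlgType R),
     lie_abelian a /\
     lie_isomorphic g ({ffun 'I_p -> heis3 R} * {ffun 'I_q -> heis4 R} * a)%type)
  /\ lie_prod fullv (lie_prod fullv (lie_prod fullv (fullv : {vspace g}))) = 0%VS.
Proof.
have [X [X_basis [lambda X_bracket]]] := milnor_g.
split; first exact: milnor_decomposition X_bracket.
exact: milnor_3step_nilpotent X_bracket.
Qed.
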